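(* Let $M$ be an $L$-structure and $\phi(x,y)$ an $L$-formula. Let $\epsilon>0$ and suppose $\phi(x,y)$ is $\epsilon$-stable in $M$. Let $p\in S_{\phi(x)}(M)$ and $q\in S_{\phi^*(y)}(M)$. Let $\psi_p(y)$, $\psi_q(x)$ and $\delta_p,\delta_q>0$ be such that 1. $\psi_p(y)$ is a $\phi^*(y)$-formula over $M$ and $\mathfrak d(\phi(p,b),\psi_p^M(b))\leq\delta_p$ for all $b\in M^y$, and 2. $\psi_q(x)$ is a $\phi(x)$-formula over $M$ and $\mathfrak d(\phi^*(q,a),\psi_q^M(a))\leq\delta_q$ for all $a\in M^x$. Then $\mathfrak d(\psi_p(q),\psi_q(p))\leq\delta_p+\delta_q+\epsilon$.
   Context: Logic: We work in continuous (metric) first-order logic with values in $\mathfrak V=\ell^\infty(\omega)$ (real Banach space), with metric $\mathfrak d(\mathfrak r,\mathfrak s)=\|\mathfrak r-\mathfrak s\|_\infty$; an isometric copy $\mathbb R\hookrightarrow\mathfrak V$ is fixed. It is set up as standard $[0,1]$-valued continuous logic (complete metric structures, possibly many-sorted, symbols with prescribed moduli of uniform continuity), except that each predicate symbol $P$ of the language $L$ comes with a compact set $K_P\subseteq\mathfrak V$ in which it takes values; connectives are all continuous functions $u:\mathfrak V^n\to\mathfrak V$; and $\sup_x\psi$, $\inf_x\psi$ are formed only for formulas $\psi$ with value set $K_\psi\subseteq\mathbb R^{\geq0}$. Inductively each formula $\phi$ has a compact value set $K_\phi\subseteq\mathfrak V$ ($K_{u(\phi_0,\ldots,\phi_{n-1})}=u(\prod_i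 K_{\phi_i})$, and $K_{\sup_x\psi}=K_{\inf_x\psi}=K_\psi$), and $\phi^M$ takes values in $K_\phi$ in every $L$-structure $M$. Here $x,y$ are tuples of variables and $M^x$ is the product of sorts of $M$ corresponding to $x$. $N\succeq M$ means $N$ is an elementary extension of $M$. Types: $\phi^*(y,x)$ is the formula $\phi(x,y)$ with the roles of object and parameter variables swapped. $S_{\phi(x)}(M)$ is the set of complete $\phi(x)$-types over $M$. A type $p\in S_{\phi(x)}(M)$ is determined by the function $b\mapsto\phi(p,b)$ from $M^y$ to $K_\phi$, where $\phi(p,b)=\phi^N(a,b)$ for any realization $a\in N^x$ of $p$ in some $N\succeq M$. Likewise, $S_{\phi^*(y)}(M)$ is the set of complete $\phi^*(y)$-types over $M$, a type $q$ being determined by $a\mapsto\phi^*(q,a)=\phi^N(a,b)$, $a\in M^x$, for any realization $b\in N^y$ of $q$. A $\phi^*(y)$-formula over $M$ is a formula of the form $u(\phi(a_0,y),\ldots,\phi(a_{n-1},y))$ with $a_i\in M^x$ and $u:\mathfrak V^n\to\mathfrak V$ continuous; a $\phi(x)$-formula over $M$ is a formula of the form $u(\phi(x,b_0),\ldots,\phi(x,b_{n-1}))$ with $b_i\in M^y$ and $u$ continuous. They are evaluated on types by evaluating at realizations: $\psi_p(q)=u(\phi^*(q,a_0),\ldots,\phi^*(q,a_{n-1}))$ for $\psi_p=u(\phi(a_0,y),\ldots,\phi(a_{n-1},y))$, and similarly for $\psi_q(p)$. Stability: $\phi(x,y)$ is $\epsilon$-stable in $M$ if there are no sequences $\langle a_i\rangle_{i<\omega}$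 in $M^x$ and $\langle b_i\rangle_{i<\omega}$ in $M^y$ such that $\mathfrak d(\phi^M(a_i,b_j),\phi^M(a_j,b_i))\geq\epsilon$ for all $i<j<\omega$. *)

(* Defs.v *)
From HB Require Import structures.
From mathcomp Require Import all_boot all_order all_algebra.
From mathcomp Require Import all_classical all_reals all_analysis.

Set Implicit Arguments.
Unset Strict Implicit.
Unset Printing Implicit Defensive.

Import Order.TTheory GRing.Theory Num.Theory.
Import numFieldNormedType.Exports.

Local Open Scope classical_set_scope.
Local Open Scope ring_scope.

(* [linf R] is the Banach space of bounded real sequences, with the supremum
   norm. *)
Definition linf_pred (R : realType) : {pred (nat -> R)} :=
  fun f => `[< bounded_fun f >].

Record linf (R : realType) := Linf {
  linf_val :> nat -> R;
  linf_valP : linf_val \in @linf_pred R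
}.

Section Linf.
Context {R : realType}.

Lemma linf_predP (f : nat -> R) :
  reflect (exists M, forall n, `|f n| <= M) (f \in @linf_pred R).
Proof.
apply: (iffP (asboolP _)).
  move=> [M [_ /(_ (M + 1))]]; rewrite ltrDl ltr01 => /(_ isT) fM.
  by exists (M + 1) => n; exact: fM.
move=> [M fM]; exists M; split; first exact: num_real.
by move=> N MN n _ /=; exact: le_trans (fM n) (ltW MN).
Qed.

HB.instance Definition _ := [isSub for @linf_val R].
HB.instance Definition _ := [Choice of linf R by <:].

Lemma linf_submod_closed : submod_closed (@linf_pred R).
Proof.
split; first by apply/linf_predP; exists 0 => n; rewrite normr0.
move=> a f g /linf_predP[M fM] /linf_predP[N gN].
apply/linf_predP; exists (`|a| * M + N) => n.
by rewrite (le_trans (ler_normD _ _))// lerD// normrM ler_wpM2l.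
Qed.

HB.instance Definition _ :=
  GRing.isSubmodClosed.Build R (nat -> R) (@linf_pred R) linf_submod_closed.
HB.instance Definition _ := [SubChoice_isSubLmodule of linf R by <:].

Definition linf_norm (f : linf R) : R := sup (range (fun n => `|f n|)).

Lemma linf_norm_has_sup (f : linf R) : has_sup (range (fun n => `|f n|)).
Proof.
split; first by exists `|f 0%N|, 0%N.
by have /linf_predP[M fM] := linf_valP f; exists M => _ [n _ <-].
Qed.

Lemma linf_norm_ub (f : linf R) n : `|f n| <= linf_norm f.
Proof. by apply: (sup_upper_bound (linf_norm_has_sup f)); exists n. Qed.

Lemma linf_norm_le (f : linf R) M : (forall n, `|f n| <= M) -> linf_norm f <= M.
Proof.
move=> fM; apply: sup_le_ub; first by have [] := linf_norm_has_sup f.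
by move=> _ [n _ <-].
Qed.

Lemma linf_normD (f g : linf R) : linf_norm (f + g) <= linf_norm f + linf_norm g.
Proof.
apply: linf_norm_le => n.
by rewrite (le_trans (ler_normD _ _))// lerD// linf_norm_ub.
Qed.

Lemma linf_normZ (a : R) (f : linf R) : linf_norm (a *: f) = `|a| * linf_norm f.
Proof.
have le_normZ b (g : linf R) : linf_norm (b *: g) <= `|b| * linf_norm g.
  by apply: linf_norm_le => n; rewrite normrM ler_wpM2l// linf_norm_ub.
apply/eqP; rewrite eq_le le_normZ/=.
have [->|a0] := eqVneq a 0.
  by rewrite normr0 mul0r (le_trans _ (linf_norm_ub _ 0%N)).
rewrite mulrC -ler_pdivlMr ?normr_gt0// mulrC -normfV.
by rewrite -[in leLHS](scalerK a0 f) le_normZ.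
Qed.

Lemma linf_norm0_eq0 (f : linf R) : linf_norm f = 0 -> f = 0.
Proof.
move=> f0; apply: val_inj; apply/funext => n; apply/eqP.
by rewrite -normr_le0 -f0; exact: linf_norm_ub.
Qed.

HB.instance Definition _ :=
  Lmodule_isNormed.Build R (linf R) linf_normD linf_normZ linf_norm0_eq0.

Lemma linf_complete (F : set_system (linf R)) :
  ProperFilter F -> cauchy F -> cvg F.
Proof.
move=> FF Fc.
have Fball e : 0 < e -> exists g : linf R, F (ball g e).
  by move/cauchyP : Fc; exact.
have Fn n : cvg ((fun f : linf R => f n) @ F).
  apply: cauchy_cvg; apply: cauchy_exP => e /Fball[g Fg]; exists (g n).
  suff : F [set f : linf R | ball (g n) e (f n)] by [].
  apply: filterS Fg => f; rewrite -!ball_normE/=.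
  exact: le_lt_trans (linf_norm_ub (g - f) n).
pose l n : R := lim ((fun f : linf R => f n) @ F).
have near_l (g : linf R) e n : F (ball g e) -> `|g n - l n| <= e.
  move=> Fge; apply/ler_addgt0Pr => d d0.
  have /cvgrPdist_lt /(_ _ d0) Fd := Fn n.
  have [f [gf /= lf]] := filter_ex (filterI Fge Fd).
  rewrite (le_trans (ler_distD (f n) _ _))// lerD//; last by rewrite distrC ltW.
  move: gf; rewrite -ball_normE/= => /ltW.
  exact: le_trans (linf_norm_ub (g - f) n).
have lP : l \in @linf_pred R.
  have [g Fg] := Fball _ ltr01.
  apply/linf_predP; exists (linf_norm g + 1) => n.
  rewrite -[l n](subrK (g n)) addrC (le_trans (ler_normD _ _))// lerD//.
    exact: linf_norm_ub.
  by rewrite distrC near_l.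
apply/cvg_ex; exists (Linf lP); apply/cvg_ballP => e e0.
have e20 : 0 < e / 2 by rewrite divr_gt0.
have [g Fg] := Fball _ e20.
apply: filterS (Fg) => f gf; rewrite (splitr e).
rewrite -ball_normE/= (le_lt_trans (ler_distD g _ _))// ler_ltD//.
by apply: linf_norm_le => n; rewrite distrC near_l.
Qed.

HB.instance Definition _ :=
  Uniform_isComplete.Build (linf R) linf_complete.

End Linf.

Record real_copy (R : realType) := RealCopy {
  rcopy :> R -> linf R;
  rcopy_isometry : forall r s, `|rcopy r - rcopy s| = `|r - s|
}.

(* Completeness comes with [isPointed], so that the sorts of a structure are
   nonempty. *)
#[short(type="completeMetricType")]
HB.structure Definition CompleteMetric (R : numDomainType) :=
  {T of Metric R T & Complete T}.

(* A finite tuple of sorted variables; it also serves as the arity of a symbol. *)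
Record ctx (S : Type) := Ctx {
  ctx_var : finType;
  ctx_sort : ctx_var -> S
}.

Section Contexts.
Context {S : Type}.

Definition ctx_ext (G : ctx S) (s : S) : ctx S :=
  @Ctx S (option (ctx_var G)) (fun o => if o is Some v then ctx_sort v else s).

Definition ctx_cat (G H : ctx S) : ctx S :=
  @Ctx S (ctx_var G + ctx_var H)%type
    (fun v => match v with inl g => ctx_sort g | inr h => ctx_sort h end).

Context (T : S -> Type).

Definition tup (G : ctx S) : Type := forall v : ctx_var G, T (ctx_sort v).

Definition tup_ext (G : ctx S) (s : S) (a : tup G) (x : T s) :
    tup (ctx_ext G s) :=
  fun o : option (ctx_var G) =>
    match o return T (@ctx_sort S (ctx_ext G s) o) with
    | Some v => a v
    | None => x
    end.

Definition tup_cat (G H : ctx S) (a : tup G) (b : tup H) : tup (ctx_cat G H) :=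
  fun v : ctx_var G + ctx_var H =>
    match v return T (@ctx_sort S (ctx_cat G H) v) with
    | inl g => a g
    | inr h => b h
    end.

End Contexts.

Definition tup_map (S : Type) (T U : S -> Type) (e : forall s, T s -> U s)
  (G : ctx S) (a : tup T G) : tup U G := fun v => e _ (a v).

Record modulus (R : realType) := Modulus {
  modulus_fun :> R -> R;
  modulus_gt0 : forall eps, 0 < eps -> 0 < modulus_fun eps
}.

Record language (R : realType) := Language {
  lsort : Type;
  fsym : Type;
  fdom : fsym -> ctx lsort;
  fcod : fsym -> lsort;
  fmod : fsym -> modulus R;
  psym : Type;
  pdom : psym -> ctx lsort;
  pmod : psym -> modulus R;
  pval : psym -> set (linf R);
  pval_compact : forall P, compact (pval P)
}.

Record structure (R : realType) (L : language R) := Structure {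
  carrier :> lsort L -> completeMetricType R;
  carrier_diam : forall s (x y : carrier s), mdist x y <= 1;
  finterp : forall f : fsym L, tup carrier (fdom f) -> carrier (fcod f);
  finterp_ucont : forall (f : fsym L) (a b : tup carrier (fdom f)) (eps : R),
    0 < eps -> (forall i, mdist (a i) (b i) < fmod f eps) ->
    mdist (finterp a) (finterp b) <= eps;
  pinterp : forall P : psym L, tup carrier (pdom P) -> linf R;
  pinterp_val : forall (P : psym L) (a : tup carrier (pdom P)),
    pval P (pinterp a);
  pinterp_ucont : forall (P : psym L) (a b : tup carrier (pdom P)) (eps : R),
    0 < eps -> (forall i, mdist (a i) (b i) < pmod P eps) ->
    `|pinterp a - pinterp b| <= eps
}.

Definition mtup (R : realType) (L : language R) (M : structure L)
  (G : ctx (lsort L)) : Type := tup (carrier M) G.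

Section Syntax.
Context {R : realType} (iota : real_copy R) (L : language R).

Inductive term (G : ctx (lsort L)) : lsort L -> Type :=
| tvar (v : ctx_var G) : term G (ctx_sort v)
| tapp (f : fsym L) (ts : forall i : ctx_var (fdom f), term G (ctx_sort i)) :
    term G (fcod f).

(* [formula G K]: formulas with free variables in [G] and value set [K]. *)
Inductive formula : ctx (lsort L) -> set (linf R) -> Type :=
| fdist G s (t1 t2 : term G s) : formula G (iota @` [set r | 0 <= r <= 1])
| fpred G (P : psym L) (ts : forall i : ctx_var (pdom P), term G (ctx_sort i)) :
    formula G (pval P)
| fconn G n (u : 'rV[linf R]_n -> linf R) (u_cont : continuous u)
    (K : 'I_n -> set (linf R)) (phi : forall i, formula G (K i)) :
    formula G (u @` [set v : 'rV_n | forall i, K i (v ord0 i)])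
| fsup G s K (K_ge0 : K `<=` iota @` [set r | 0 <= r])
    (psi : formula (ctx_ext G s) K) : formula G K
| finf G s K (K_ge0 : K `<=` iota @` [set r | 0 <= r])
    (psi : formula (ctx_ext G s) K) : formula G K.

Definition tsubstitution (G H : ctx (lsort L)) :=
  forall v : ctx_var G, term H (ctx_sort v).

Fixpoint tsubst G H (sg : tsubstitution G H) s (t : term G s) : term H s :=
  match t with
  | tvar v => sg v
  | tapp f ts => tapp (fun i => tsubst sg (ts i))
  end.

Definition tsubst_ext G H (sg : tsubstitution G H) s :
    tsubstitution (ctx_ext G s) (ctx_ext H s) :=
  fun o : option (ctx_var G) =>
    match o return term (ctx_ext H s) (@ctx_sort _ (ctx_ext G s) o) with
    | Some v =>
        tsubst (fun w => @tvar (ctx_ext H s) (Some w)) (sg v)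
    | None => @tvar (ctx_ext H s) None
    end.

Fixpoint fsubst G K (phi : formula G K) :
    forall H, tsubstitution G H -> formula H K :=
  match phi with
  | fdist G s t1 t2 => fun H sg => fdist (tsubst sg t1) (tsubst sg t2)
  | fpred G P ts => fun H sg => fpred (fun i => tsubst sg (ts i))
  | fconn G n u cu K phi => fun H sg => fconn cu (fun i => fsubst (phi i) sg)
  | fsup G s K K0 psi => fun H sg => fsup K0 (fsubst psi (tsubst_ext sg (s := s)))
  | finf G s K K0 psi => fun H sg => finf K0 (fsubst psi (tsubst_ext sg (s := s)))
  end.

(* For a formula [phi(x, y)], the formula [phi^*(y, x)]. *)
Definition fswap (X Y : ctx (lsort L)) K (phi : formula (ctx_cat X Y) K) :
    formula (ctx_cat Y X) K :=
  fsubst phi (fun v : ctx_var X + ctx_var Y =>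
    match v return term (ctx_cat Y X) (@ctx_sort _ (ctx_cat X Y) v) with
    | inl x => @tvar (ctx_cat Y X) (inr x)
    | inr y => @tvar (ctx_cat Y X) (inl y)
    end).

End Syntax.

Section Semantics.
Context {R : realType} {iota : real_copy R} {L : language R}.

Fixpoint teval (M : structure L) G s (t : term G s) (a : mtup M G) : M s :=
  match t with
  | tvar v => a v
  | tapp f ts => finterp (fun i => teval (ts i) a)
  end.

(* [K_ge0] puts the values of [psi] in the copy of the reals, where the
   supremum and the infimum are taken. *)
Fixpoint feval (M : structure L) G K (phi : formula iota G K) :
    mtup M G -> linf R :=
  match phi with
  | fdist G s t1 t2 => fun a => iota (mdist (teval t1 a) (teval t2 a))
  | fpred G P ts => fun a => pinterp (fun i => teval (ts i) a)
  | fconn G n u _ K phi => fun a => u (\row_i feval (phi i) a)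
  | fsup G s K _ psi => fun a =>
      iota (sup [set r | exists x : M s, feval psi (tup_ext a x) = iota r])
  | finf G s K _ psi => fun a =>
      iota (inf [set r | exists x : M s, feval psi (tup_ext a x) = iota r])
  end.

End Semantics.

Section Elementary.
Context {R : realType} (iota : real_copy R) {L : language R}.

(* [N] is an elementary extension of [M], up to the identification of [M] with
   its image. *)
Record elementary_extension (M N : structure L) := ElementaryExtension {
  eext :> forall s, M s -> N s;
  eext_elementary : forall G K (phi : formula iota G K) (a : mtup M G),
    feval phi (tup_map eext a) = feval phi a
}.

End Elementary.

(* A [phi(x)]-formula [u(phi(x, b_0), ..., phi(x, b_{n-1}))] over [M]; [phi]
   enters only through the evaluations [lform_eval] and [lform_at]. *)
Record local_formula (R : realType) (iota : real_copy R) (L : language R)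
    (M : structure L) (X Y : ctx (lsort L)) (K : set (linf R))
    (phi : formula iota (ctx_cat X Y) K) := LocalFormula {
  lform_arity : nat;
  lform_param : 'I_lform_arity -> mtup M Y;
  lform_conn : 'rV[linf R]_lform_arity -> linf R;
  lform_conn_continuous : continuous lform_conn
}.

Arguments lform_param {R iota L M X Y K phi} _ _.
Arguments lform_conn {R iota L M X Y K phi} _ _.

Section Local.
Context {R : realType} {iota : real_copy R} {L : language R}.
Context (M : structure L) (X Y : ctx (lsort L)) (K : set (linf R))
  (phi : formula iota (ctx_cat X Y) K).

(* A complete [phi(x)]-type [p] over [M], as the function [b |-> phi(p, b)]. *)
Record local_type := LocalType {
  ltype_val :> mtup M Y -> linf R;
  ltype_realized : exists (N : structure L) (e : elementary_extension iota M N)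
    (a : mtup N X), forall b : mtup M Y,
      ltype_val b = feval phi (tup_cat a (tup_map e b))
}.

Definition lform_eval (psi : local_formula M phi) (a : mtup M X) : linf R :=
  lform_conn psi (\row_i feval phi (tup_cat a (lform_param psi i))).

Definition lform_at (psi : local_formula M phi) (p : local_type) : linf R :=
  lform_conn psi (\row_i p (lform_param psi i)).

Definition stable_in (eps : R) : Prop :=
  ~ exists (a : nat -> mtup M X) (b : nat -> mtup M Y),
      forall i j, (i < j)%N ->
        eps <= `|feval phi (tup_cat (a i) (b j)) -
                 feval phi (tup_cat (a j) (b i))|.

End Local.

(* Main.v *)
(* Types over M are finitely satisfiable in M, so one can choose a_n in M
   approximating p on b_0, ..., b_{n-1} and on the parameters of psi_q, and b_n
   approximating q on a_0, ..., a_{n-1} and on the parameters of psi_p. For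
   i < j, phi(a_i, b_j) is close to q(a_i), hence within about delta_q of
   psi_q(p), while phi(a_j, b_i) is close to p(b_i), hence within about delta_p
   of psi_p(q). If psi_p(q) and psi_q(p) were more than
   delta_p + delta_q + eps apart, these sequences would contradict
   eps-stability. *)
Require Import Defs.
From mathcomp Require Import all_boot all_order all_algebra.
From mathcomp Require Import all_classical all_reals all_analysis lra.

Set Implicit Arguments.
Unset Strict Implicit.
Unset Printing Implicit Defensive.

Import Order.TTheory GRing.Theory Num.Theory.
Import numFieldNormedType.Exports.

Local Open Scope ring_scope.

(** Builds sequences in which each term must meet conditions on all earlier ones: the chosen step is
    iterated on the growing list of previous terms. *)
Lemma history_choice (T : Type) (P : seq T -> T -> Prop) :
  (forall h, exists x, P h x) ->
  exists f : nat -> T, forall n, P (mkseq f n) (f n).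
Proof.
move=> /choice[step stepP].
pose hist n := iter n (fun h => rcons h (step h)) [::].
exists (step \o hist) => n /=.
suff -> : mkseq (step \o hist) n = hist n by exact: stepP.
by elim: n => // n IHn; rewrite mkseqS IHn.
Qed.

(** * Substitution and swapping of variables *)

Section Substitution.
Context {R : realType} {iota : real_copy R} {L : language R}.

Lemma teval_tsubst (M : structure L) G H (sg : tsubstitution G H) s
    (t : term G s) (a : mtup M H) :
  teval (tsubst sg t) a = teval t (fun v => teval (sg v) a).
Proof.
elim: t => //= f ts IH; congr finterp.
by apply: functional_extensionality_dep => i.
Qed.

Lemma teval_tsubst_ext (M : structure L) G H (sg : tsubstitution G H) s
    (a : mtup M H) (x : M s) :
  (fun v => teval (tsubst_ext sg v) (tup_ext (T := carrier M) a x)) =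
  tup_ext (T := carrier M) (fun v => teval (sg v) a) x.
Proof.
by apply: functional_extensionality_dep => -[v|] //=; rewrite teval_tsubst.
Qed.

Lemma feval_fsubst (M : structure L) G K (phi : formula iota G K) H
    (sg : tsubstitution G H) (a : mtup M H) :
  feval (fsubst phi sg) a = feval phi (fun v => teval (sg v) a).
Proof.
elim: phi H sg a => {G K} /=.
- by move=> G s t1 t2 H sg a; rewrite !teval_tsubst.
- move=> G P ts H sg a; congr pinterp.
  by apply: functional_extensionality_dep => i; rewrite teval_tsubst.
- move=> G n u cu K phi IH H sg a; congr u.
  by apply/rowP => i; rewrite !mxE IH.
- move=> G s K K0 psi IH H sg a; congr (iota (sup _)).
  by apply/funext => r; apply/propext; split=> -[x];
    rewrite ?IH ?teval_tsubst_ext => xr; exists x; rewrite ?IH ?teval_tsubst_ext.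
- move=> G s K K0 psi IH H sg a; congr (iota (inf _)).
  by apply/funext => r; apply/propext; split=> -[x];
    rewrite ?IH ?teval_tsubst_ext => xr; exists x; rewrite ?IH ?teval_tsubst_ext.
Qed.

Lemma feval_fswap (M : structure L) X Y K (phi : formula iota (ctx_cat X Y) K)
    (a : mtup M X) (b : mtup M Y) :
  feval (fswap phi) (tup_cat b a) = feval phi (tup_cat a b).
Proof.
rewrite feval_fsubst; congr (feval phi _).
by apply: functional_extensionality_dep => -[].
Qed.

Lemma rcopy_inj : injective iota.
Proof.
by move=> r s rs; apply/eqP; rewrite -subr_eq0 -normr_eq0 -(rcopy_isometry iota)
  rs subrr normr0.
Qed.

Lemma rcopy_continuous : continuous iota.
Proof.
move=> r; apply/cvgrPdist_lt => e e0; near=> s.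
by rewrite rcopy_isometry; near: s; apply: cvgr_dist_lt.
Unshelve. all: by end_near. Qed.

(** * Transfer to [M] and finite satisfiability of local types *)

Definition tsubst_bind G (v : ctx_var G) :
    @tsubstitution _ L G (ctx_ext G (ctx_sort v)) :=
  dfwith (fun w => @tvar _ L (ctx_ext G (ctx_sort v)) (Some w)) v
         (@tvar _ L (ctx_ext G (ctx_sort v)) None).

(** [finf] binds only the variable added by [ctx_ext], so [v] is first renamed to it. The result
    stays in the context [G], which lets an induction over variables keep its context fixed. *)
Definition finf_at G K (K_ge0 : (K `<=` iota @` [set r | 0 <= r])%classic)
    (chi : formula iota G K) (v : ctx_var G) : formula iota G K :=
  finf K_ge0 (fsubst chi (@tsubst_bind G v)).

Lemma feval_finf_at (M : structure L) G K K_ge0 (chi : formula iota G K)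
    (v : ctx_var G) (a : mtup M G) :
  feval (finf_at K_ge0 chi v) a =
  iota (inf
    [set r | exists x, feval chi (dfwith a v x : mtup M G) = iota r]%classic).
Proof.
rewrite /=; congr (iota (inf _)); apply/funext => r.
have bindE x : (fun w => teval (@tsubst_bind G v w) (tup_ext a x)) = dfwith a v x.
  apply: functional_extensionality_dep => w; rewrite /tsubst_bind.
  by case: dfwithP => [|w' vw']; rewrite ?dfwithin ?dfwithout.
by apply/propext; split=> -[x]; rewrite ?feval_fsubst ?bindE => xr;
  exists x; rewrite ?feval_fsubst ?bindE.
Qed.

(* [c] agrees with a tuple of [M] outside [s]; the remaining coordinates are
   brought into [M] one at a time, by quantifying each of them with an infimum
   and transferring the value of the resulting formula from [N] to [M]. *)
Lemma elementary_approx (M N : structure L) (e : elementary_extension iota M N)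
    G K (K_ge0 : (K `<=` iota @` [set r | 0 <= r])%classic) (s : seq (ctx_var G))
    (chi : formula iota G K)
    (chi_ge0 : forall (Q : structure L) (a : mtup Q G),
      exists2 r, 0 <= r & feval chi a = iota r)
    (c : mtup N G) (m : mtup M G) (r r' : R) :
  (forall v, v \notin s -> c v = e _ (m v)) -> feval chi c = iota r -> r < r' ->
  exists m' : mtup M G, (forall v, v \notin s -> m' v = m v) /\
    exists2 t, t < r' & feval chi m' = iota t.
Proof.
elim: s chi chi_ge0 c r => [|v s IH] chi chi_ge0 c r cm chir rr'.
  exists m; split=> //; exists r => //.
  have cE : c = tup_map e m.
    by apply: functional_extensionality_dep => v; exact: cm.
  by rewrite -chir cE eext_elementary.
pose B (Q : structure L) (a : mtup Q G) :=
  [set r | exists x, feval chi (dfwith a v x : mtup Q G) = iota r]%classic.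
have B0 Q (a : mtup Q G) : (B Q a !=set0)%classic.
  by have [t _ ta] := chi_ge0 Q (dfwith a v (a v)); exists t, (a v).
have B_ge0 Q (a : mtup Q G) : lbound (B Q a) 0.
  move=> t [x]; have [t' t'0 ->] := chi_ge0 Q (dfwith a v x).
  by move=> /rcopy_inj <-.
pose c' : mtup N G := dfwith c v (e _ (m v)).
have c'm w : w \notin s -> c' w = e _ (m w).
  rewrite /c'; case: dfwithP => // w' vw' w's; apply: cm.
  by rewrite inE negb_or eq_sym vw'.
(* The old coordinate [c v] competes in this infimum and gives the value [r], so overwriting
   coordinate [v] of [c] costs nothing. *)
have infr : inf (B N c') < r'.
  apply: le_lt_trans rr'; apply: ge_inf; first by exists 0; exact: B_ge0.
  exists (c v); rewrite -chir; congr feval.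
  apply: functional_extensionality_dep => w.
  by rewrite /c'; case: dfwithP => // w' vw'; rewrite dfwithout.
have chi'_ge0 Q (a : mtup Q G) :
    exists2 r, 0 <= r & feval (finf_at K_ge0 chi v) a = iota r.
  exists (inf (B Q a)); last exact: feval_finf_at.
  exact: lb_le_inf.
have [m1 [m1m [t tr']]] := IH _ chi'_ge0 _ _ c'm (feval_finf_at _ _ _ _) infr.
rewrite feval_finf_at => /rcopy_inj m1t.
(* The infimum at [m1] need not be attained, but as it lies strictly below [r'], some [x] in [M]
   gives a value below [r']. *)
have [|u [x xu] ur'] := @inf_lt _ (B M m1) r' (B0 _ _).
  by rewrite m1t.
exists (dfwith m1 v x); split; last by exists u.
by move=> w; rewrite inE negb_or eq_sym => /andP[vw ws]; rewrite dfwithout// m1m.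
Qed.

(** The sum of the errors at the [b i] is a formula with nonnegative real values which vanishes at a
    realization of [p] in some [N]; hence it takes values below [theta] in [M], and it bounds each
    error. *)
Lemma ltype_fin_sat (M : structure L) X Y K (phi : formula iota (ctx_cat X Y) K)
    (p : local_type M phi) (I : finType) (b : I -> mtup M Y) (theta : R) :
  0 < theta ->
  exists a : mtup M X, forall i, `|p (b i) - feval phi (tup_cat a (b i))| < theta.
Proof.
move=> theta0; have [N [e [a0 pa0]]] := ltype_realized p.
(* Formulas contain no parameters, so each [b i] becomes the value of its own copy of the variables
   [Y]; the numbers [p (b i)] are absorbed into the connective [D]. *)
pose Z := @Ctx _ (ctx_var X + I * ctx_var Y)%type
  (fun v => match v with inl x => ctx_sort x | inr w => ctx_sort w.2 end).
pose sg i : @tsubstitution _ L (ctx_cat X Y) Z := fun v : ctx_var X + ctx_var Y =>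
  match v return term Z (@ctx_sort _ (ctx_cat X Y) v) with
  | inl x => @tvar _ L Z (inl x)
  | inr y => @tvar _ L Z (inr (i, y))
  end.
pose D (v : 'rV[linf R]_#|I|) : R := \sum_i `|p (b (enum_val i)) - v ord0 i|.
have D_cont : continuous D.
  apply: (@continuous_big R _ +%R 0 xpredT) => [|i _]; first exact: add_continuous.
  move=> v; apply: (@cvg_norm _ (linf R) _ (nbhs v) _
    (cst (p (b (enum_val i))) \- fun w => w ord0 i)).
  apply: cvgB; first exact: cvg_cst.
  apply/cvg_ballP => d d0; apply/nbhs_ballP; exists d => //= w [_ vw].
  exact: vw.
have u_cont : continuous (iota \o D).
  by move=> v; apply: continuous_comp; [exact: D_cont | exact: rcopy_continuous].
have D_ge0 v : 0 <= D v by apply: sumr_ge0.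
pose chi := fconn u_cont (fun i => fsubst phi (sg (enum_val i))).
have chiE (Q : structure L) (z : mtup Q Z) : feval chi z = iota (\sum_(i < #|I|)
    `|p (b (enum_val i)) - feval phi (tup_cat (fun x => z (inl x))
                                (fun y => z (inr (enum_val i, y))))|).
  rewrite /= /D; congr (iota _); apply: eq_bigr => i _; rewrite mxE feval_fsubst.
  by congr (`|_ - feval phi _|); apply: functional_extensionality_dep => -[].
(* Quantification requires the whole value set, not only the attained values, to be nonnegative; [D]
   is nonnegative everywhere. *)
have chi_val :
    ((iota \o D) @` [set v : 'rV_#|I| | forall i : 'I_#|I|, K (v ord0 i)] `<=`
      iota @` [set r | 0 <= r])%classic.
  by move=> _ [v _ <-]; exists (D v) => //=; exact: D_ge0.
have chi_ge0 (Q : structure L) (z : mtup Q Z) :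
    exists2 r, 0 <= r & feval chi z = iota r.
  by rewrite chiE; eexists; last reflexivity; exact: sumr_ge0.
pose c : mtup N Z := fun v => match v return N (@ctx_sort _ Z v) with
  | inl x => a0 x
  | inr w => e _ (b w.1 w.2)
  end.
(* The coordinates in [X] are arbitrary here: they are the ones that [elementary_approx]
   replaces. *)
pose m : mtup M Z := fun v => match v return M (@ctx_sort _ Z v) with
  | inl x => point
  | inr w => b w.1 w.2
  end.
have cm v : v \notin [seq inl x | x : ctx_var X] -> c v = e _ (m v).
  by case: v => // x; rewrite map_f ?mem_enum.
have chic : feval chi c = iota 0.
  rewrite chiE big1// => i _; rewrite pa0; apply/eqP.
  by rewrite normr_eq0 subr_eq0; apply/eqP; congr feval.
have [m' [m'm [t t_theta]]] := elementary_approx chi_val chi_ge0 cm chic theta0.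
rewrite chiE => /rcopy_inj tE; exists (fun x => m' (inl x)) => i.
apply: le_lt_trans t_theta; rewrite -tE (bigD1 (enum_rank i))//= enum_rankK.
have -> : (fun y => m' (inr (i, y))) = b i.
  apply: functional_extensionality_dep => y; rewrite m'm//.
  by apply/negP => /mapP[].
by rewrite lerDl sumr_ge0.
Qed.

(** By continuity of the connective at the values of [p], it suffices to approximate [p] closely on
    the parameters of [psi] together with the entries of [s]. *)
Lemma ltype_fin_sat_lform (M : structure L) X Y K
    (phi : formula iota (ctx_cat X Y) K) (p : local_type M phi)
    (psi : local_formula M phi) (s : seq (mtup M Y)) (theta : R) :
  0 < theta ->
  exists a : mtup M X, `|lform_eval psi a - lform_at psi p| < theta /\
    forall b0 i, (i < size s)%N ->
      `|p (nth b0 s i) - feval phi (tup_cat a (nth b0 s i))| < theta.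
Proof.
move=> theta0; pose r := \row_i p (lform_param psi i).
have /cvgrPdist_lt/(_ _ theta0)/nbhs_ballP[d /= d0 rd] :=
  @lform_conn_continuous _ _ _ _ _ _ _ _ psi r.
pose b (k : 'I_(size s) + 'I_(lform_arity psi)) : mtup M Y :=
  match k with inl i => tnth (in_tuple s) i | inr j => lform_param psi j end.
have dtheta0 : 0 < Num.min d theta by rewrite lt_min d0.
have [a pa] := ltype_fin_sat p b dtheta0; exists a; split.
  rewrite distrC; apply: rd; split => // i j; rewrite !mxE -ball_normE /=.
  by have := pa (inr j); rewrite lt_min => /andP[].
move=> b0 i si; have := pa (inl (Ordinal si)).
by rewrite /= (tnth_nth b0) lt_min => /andP[].
Qed.

End Substitution.

Theorem proposition3p10 (R : realType) (iota : real_copy R) (L : language R)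
  (M : structure L) (X Y : ctx (lsort L)) (K : set (linf R))
  (phi : formula iota (ctx_cat X Y) K)
  (eps : R) (eps_gt0 : 0 < eps) (phi_stable : stable_in M phi eps)
  (p : local_type M phi) (q : local_type M (fswap phi))
  (psi_p : local_formula M (fswap phi)) (psi_q : local_formula M phi)
  (delta_p delta_q : R) (delta_p_gt0 : 0 < delta_p) (delta_q_gt0 : 0 < delta_q)
  (psi_p_def : forall b : mtup M Y, `|p b - lform_eval psi_p b| <= delta_p)
  (psi_q_def : forall a : mtup M X, `|q a - lform_eval psi_q a| <= delta_q) :
  `|lform_at psi_p q - lform_at psi_q p| <= delta_p + delta_q + eps.
Proof.
set x := lform_at psi_p q; set y := lform_at psi_q p.
rewrite leNgt; apply/negP => gap; apply: phi_stable.
(* The path from [x] to [y] through [v] and [u] below contains four errors smaller than [theta]; a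
   quarter of the excess leaves more than [eps] for the distance between [u] and [v]. *)
pose theta := (`|x - y| - (delta_p + delta_q + eps)) / 4.
have theta0 : 0 < theta by rewrite divr_gt0 ?subr_gt0.
(* The two entries of a pair are constrained only by earlier pairs, not by each other, so they can
   be chosen independently. *)
pose step (h : seq (mtup M X * mtup M Y)) (ab : mtup M X * mtup M Y) :=
  [/\ `|lform_eval psi_q ab.1 - y| < theta,
      `|lform_eval psi_p ab.2 - x| < theta &
      forall ab0 i, (i < size h)%N ->
        `|p (nth ab0 h i).2 - feval phi (tup_cat ab.1 (nth ab0 h i).2)| < theta /\
        `|q (nth ab0 h i).1 - feval phi (tup_cat (nth ab0 h i).1 ab.2)| < theta].
have stepP h : exists ab, step h ab.
  have [a [pa ha]] := ltype_fin_sat_lform p psi_q (unzip2 h) theta0.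
  have [b [qb hb]] := ltype_fin_sat_lform q psi_p (unzip1 h) theta0.
  exists (a, b); split => // ab0 i hi; split => /=.
    by have := ha ab0.2 i; rewrite size_map (nth_map ab0)//; exact.
  have := hb ab0.1 i; rewrite size_map (nth_map ab0)// feval_fswap; exact.
have [f fP] := history_choice stepP.
exists (fst \o f), (snd \o f) => i j ij /=.
(* Stage [i] controls the local formulas at the pair [f i]; the later stage [j] controls [phi]
   between [f i] and [f j]. *)
have [ay bx _] := fP i; have [_ _ /(_ (f 0%N) i)] := fP j.
rewrite size_mkseq nth_mkseq// => /(_ ij)[].
have := psi_p_def (f i).2; have := psi_q_def (f i).1.
set a := lform_eval psi_q (f i).1 in ay *.
set b := lform_eval psi_p (f i).2 in bx *.
set u := feval phi (tup_cat (f i).1 _); set v := feval phi (tup_cat _ (f i).2).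
move=> qa pb pv qu.
have xv : `|x - v| <= `|b - x| + `|p (f i).2 - b| + `|p (f i).2 - v|.
  rewrite -addrA (distrC b x) (distrC (p _) b).
  by rewrite (le_trans (ler_distD b _ _))// lerD2l ler_distD.
have uy : `|u - y| <= `|q (f i).1 - u| + `|q (f i).1 - a| + `|a - y|.
  rewrite -addrA (distrC (q _) u) (le_trans (ler_distD (q (f i).1) _ _))//.
  by rewrite lerD2l ler_distD.
have xy : `|x - y| <= `|x - v| + `|u - v| + `|u - y|.
  rewrite -addrA (distrC u v) (le_trans (ler_distD v _ _))//.
  by rewrite lerD2l ler_distD.
have thetaE : theta * 4 = `|x - y| - (delta_p + delta_q + eps) by rewrite divfK.
lra.
Qed.
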